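(* Let $N,k\ge1$, $p\ge0$ be integers, and let $r(u^1,\dots,u^N)$ be a $k$-potential $N$-dimensional submanifold with data $(\Phi,\eta,c,\mu)$ in a $((k+1)N+p)$-dimensional pseudo-Euclidean space, with flat coordinates $u$, first fundamental form $\eta_{ij}\,du^i\,du^j$, second fundamental forms $\omega_{\alpha ij}\,du^i\,du^j$, and Weingarten operators $$(A_{(s-1)N+m})^i_j(u)=-\sum_{l=1}^N\eta^{il}\,\omega_{(s-1)N+m,\,lj}(u),\qquad 1\le s\le k,\ 1\le i,j,m\le N.$$ For each $s$, $1\le s\le k$, put $e_i=\partial/\partial u^i$ and define on the tangent spaces $$\langle e_i,e_j\rangle=\eta_{ij},\qquad e_m\circ e_j=\sum_{l=1}^N c^l_{mj}(u)\,e_l,\qquad c^l_{mj}(u)=-(A_{(s-1)N+m})^l_j(u)=\sum_{i=1}^N\eta^{li}\,\omega_{(s-1)N+m,\,ij}(u).$$ Then for each $s$ this defines on the submanifold a Dubrovin--Frobenius structure (in particular, a commutative Frobenius algebra structure on every tangent space), and the $k$ structures obtained for $s=1,\dots,k$ are identical.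
   Context: **Frobenius algebra.** A finite-dimensional associative algebra (unit not required) with a nondegenerate symmetric bilinear form $f$ that is invariant: $f(a\circ b,c)=f(a,b\circ c)$. **Dubrovin--Frobenius structure** on a manifold: a pseudo-Riemannian metric $g$ and a multiplication $\circ$ on each tangent space, depending smoothly on the point, such that for all vector fields $X,Y,Z,W$: (I) $g(X\circ Y,Z)=g(X,Y\circ Z)$; (II) $X\circ Y=Y\circ X$; (III) $(X\circ Y)\circ Z=X\circ(Y\circ Z)$; (IV) $g$ is flat; (V) $A(X,Y,Z)=g(X\circ Y,Z)$ is a symmetric tensor such that $(\nabla_WA)(X,Y,Z)$ is symmetric in $X,Y,Z,W$, with $\nabla$ the Levi-Civita connection of $g$. Here $g=\langle\cdot,\cdot\rangle$. **Associativity (WDVV) equations** for $\Phi$ and $(\eta^{ij})$: for all $i,j,m,n$, $$\sum_{a,b=1}^N\frac{\partial^3\Phi}{\partial u^i\partial u^j\partial u^a}\eta^{ab}\frac{\partial^3\Phi}{\partial u^b\partial u^m\partial u^n}=\sum_{a,b=1}^N\frac{\partial^3\Phi}{\partial u^i\partial u^m\partial u^a}\eta^{ab}\frac{\partial^3\Phi}{\partial u^b\partial u^j\partial u^n}.$$ **$k$-potential submanifold with data $(\Phi,\eta,c,\mu)$.** Let $L=kN+p$. The data consist of: a constant nondegenerate symmetric $N\times N$ matrix $(\eta^{ij})$ with inverse $(\eta_{ij})$; a constant nondegenerate symmetric $k\times k$ matrix $(c^{\sigma\tau})$ (unrelated to the structure functions $c^l_{mj}$); a constant nondegenerate symmetric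 $L\times L$ matrix $(\mu^{\alpha\beta})$ with inverse $(\mu_{\alpha\beta})$ and $\mu^{(\sigma-1)N+m,\,(\tau-1)N+n}=c^{\sigma\tau}\eta^{mn}$ for $1\le\sigma,\tau\le k$, $1\le m,n\le N$; and a smooth solution $\Phi(u)$ of the associativity equations. A $k$-potential submanifold with these data is an immersed $N$-dimensional submanifold $r(u)$ of an $(N+L)$-dimensional pseudo-Euclidean space (scalar product $(\cdot,\cdot)$) that admits a smooth basis $n_1,\dots,n_L$ of the normal spaces for which: $(\partial_ir,\partial_jr)=\eta_{ij}$ (first fundamental form); $(n_\alpha,n_\beta)=\mu_{\alpha\beta}$; the torsion coefficients $(\partial_in_\alpha,n_\beta)$ vanish; and the second fundamental forms $\omega_{\alpha ij}=(\partial_i\partial_jr,n_\alpha)$ satisfy $\omega_{(\sigma-1)N+m,\,ij}=\partial^3\Phi/\partial u^m\partial u^i\partial u^j$ for $1\le\sigma\le k$, $1\le m\le N$, and $\omega_{\alpha ij}=0$ for $kN+1\le\alpha\le L$. *)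

(* Defs.v *)
From HB Require Import structures.
From mathcomp Require Import all_boot all_order all_algebra.
From mathcomp Require Import all_classical all_reals all_analysis.
Set Implicit Arguments.
Unset Strict Implicit.
Unset Printing Implicit Defensive.
Import Order.TTheory GRing.Theory Num.Theory.
Import numFieldNormedType.Exports.
Local Open Scope classical_set_scope.
Local Open Scope ring_scope.

(* (x, y) for the Gram matrix G. *)
Definition bform (R : realType) (n : nat) (G : 'M[R]_n) (x y : 'rV[R]_n) : R :=
  (x *m G *m y^T) 0 0.

Definition nondeg_sym (R : realType) (n : nat) (G : 'M[R]_n) : Prop :=
  G^T = G /\ G \in unitmx.

Record Frobenius_algebra (K : fieldType) (V : vectType K)
    (mul : V -> V -> V) (f : V -> V -> K) : Prop := {
  FA_mul_linear : forall a, linear (mul a) /\ linear (mul^~ a);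
  FA_mulA : associative mul;
  FA_form_linear : forall a, scalar (f a) /\ scalar (f^~ a);
  FA_form_sym : forall a b, f a b = f b a;
  FA_form_nondeg : forall a, (forall b, f a b = 0) -> a = 0;
  FA_invariant : forall a b c, f (mul a b) c = f a (mul b c)
}.

Section Calculus.
Variables (R : realType) (N : nat).

Definition pderive (V : normedModType R) (i : 'I_N) (f : 'rV[R]_N -> V) :
    'rV[R]_N -> V :=
  fun u => 'D_(delta_mx 0 i) f u.

(* f is C^oo on the open set U: all iterated partial derivatives exist and are
   (Frechet-)differentiable, hence continuous, at every point of U.  Since U is
   open, the values of f outside U are irrelevant. *)
Definition smooth_on (V : normedModType R) (U : set 'rV[R]_N)
    (f : 'rV[R]_N -> V) : Prop :=
  forall (s : seq 'I_N) (u : 'rV[R]_N), U u ->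
    differentiable (foldr (@pderive V) f s) u.

End Calculus.

(* Geometry on an open set U of R^N.  The tangent space at a point is 'rV[R]_N,
   with e_i = d/du^i = delta_mx 0 i.  A metric field g is given by its Gram
   matrices (g_ij); a multiplication field by functions c u l m j = c^l_{mj}(u),
   with e_m o e_j = \sum_l c^l_{mj}(u) e_l. *)
Section DubrovinFrobenius.
Variables (R : realType) (N : nat).
Local Notation pt := 'rV[R]_N.
Local Notation field := ('rV[R]_N -> 'rV[R]_N).
Implicit Types (U : set pt) (g : pt -> 'M[R]_N).
Implicit Types (c : pt -> 'I_N -> 'I_N -> 'I_N -> R) (W X Y Z : field).

Definition tmul (cu : 'I_N -> 'I_N -> 'I_N -> R) (x y : 'rV[R]_N) : 'rV[R]_N :=
  \row_l \sum_m \sum_j x 0 m * y 0 j * cu l m j.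

Definition fmul c X Y : field := fun u => tmul (c u) (X u) (Y u).

Definition fprod g X Y : pt -> R := fun u => bform (g u) (X u) (Y u).

Definition pseudo_riemannian U g : Prop :=
  (forall i j, smooth_on U (fun u => g u i j)) /\
  (forall u, U u -> nondeg_sym (g u)).

(* Christoffel symbols Gamma^k_{ij} of the Levi-Civita connection. *)
Definition christoffel g (u : pt) (k i j : 'I_N) : R :=
  2^-1 * \sum_l invmx (g u) k l *
    (pderive i (fun v => g v j l) u + pderive j (fun v => g v i l) u
     - pderive l (fun v => g v i j) u).

Definition nabla g X Y : field := fun u =>
  'D_(X u) Y u + tmul (christoffel g u) (X u) (Y u).

Definition bracket X Y : field := fun u => 'D_(X u) Y u - 'D_(Y u) X u.

Definition curvature g X Y Z : field := fun u =>
  nabla g X (nabla g Y Z) u - nabla g Y (nabla g X Z) u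
  - nabla g (bracket X Y) Z u.

Definition flat_metric U g : Prop :=
  forall X Y Z, smooth_on U X -> smooth_on U Y -> smooth_on U Z ->
  forall u, U u -> curvature g X Y Z u = 0.

Definition tensorA g c X Y Z : pt -> R := fprod g (fmul c X Y) Z.

Definition nablaA g c W X Y Z : pt -> R := fun u =>
  'D_(W u) (tensorA g c X Y Z) u
  - tensorA g c (nabla g W X) Y Z u
  - tensorA g c X (nabla g W Y) Z u
  - tensorA g c X Y (nabla g W Z) u.

(* Total symmetry is expressed through adjacent transpositions. *)
Record Dubrovin_Frobenius U g c : Prop := {
  DF_metric : pseudo_riemannian U g;
  DF_mul_smooth : forall l m j, smooth_on U (fun u => c u l m j);
  DF_invariant : forall X Y Z,
    smooth_on U X -> smooth_on U Y -> smooth_on U Z ->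
    forall u, U u -> fprod g (fmul c X Y) Z u = fprod g X (fmul c Y Z) u;
  DF_mulC : forall X Y, smooth_on U X -> smooth_on U Y ->
    forall u, U u -> fmul c X Y u = fmul c Y X u;
  DF_mulA : forall X Y Z,
    smooth_on U X -> smooth_on U Y -> smooth_on U Z ->
    forall u, U u -> fmul c (fmul c X Y) Z u = fmul c X (fmul c Y Z) u;
  DF_flat : flat_metric U g;
  DF_A_sym : forall X Y Z,
    smooth_on U X -> smooth_on U Y -> smooth_on U Z ->
    forall u, U u ->
      tensorA g c X Y Z u = tensorA g c Y X Z u /\
      tensorA g c X Y Z u = tensorA g c X Z Y u;
  DF_nablaA_sym : forall W X Y Z,
    smooth_on U W -> smooth_on U X -> smooth_on U Y -> smooth_on U Z ->
    forall u, U u ->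
      [/\ nablaA g c W X Y Z u = nablaA g c X W Y Z u,
          nablaA g c W X Y Z u = nablaA g c W Y X Z u &
          nablaA g c W X Y Z u = nablaA g c W X Z Y u]
}.

End DubrovinFrobenius.

Fact block_idx_subproof (k N p : nat) (s : 'I_k) (m : 'I_N) :
  (s * N + m < k * N + p)%N.
Proof.
apply: (@leq_trans (s.+1 * N)); first by rewrite mulSn addnC ltn_add2r.
by rewrite (leq_trans _ (leq_addr _ _))// leq_mul2r (ltn_ord s) orbT.
Qed.

(* The index (s-1)N+m of 1 <= s <= k, 1 <= m <= N, counted from 0. *)
Definition block_idx (k N p : nat) (s : 'I_k) (m : 'I_N) : 'I_(k * N + p) :=
  Ordinal (block_idx_subproof p s m).

Section Submanifold.
Variables (R : realType) (N k p : nat).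
Local Notation pt := 'rV[R]_N.
Local Notation L := (k * N + p)%N.
Local Notation D := (k.+1 * N + p)%N.
Implicit Types (U : set pt) (Phi : pt -> R).
Implicit Types (eta : 'M[R]_N) (c : 'M[R]_k) (mu : 'M[R]_L) (G : 'M[R]_D).
Implicit Types (r : pt -> 'rV[R]_D) (n : 'I_L -> pt -> 'rV[R]_D).

Definition d3 Phi (i j l : 'I_N) : pt -> R :=
  pderive i (pderive j (pderive l Phi)).

(* eta is the matrix (eta^{ij}). *)
Definition WDVV U eta Phi : Prop :=
  forall u, U u -> forall i j m n : 'I_N,
    \sum_a \sum_b d3 Phi i j a u * eta a b * d3 Phi b m n u =
    \sum_a \sum_b d3 Phi i m a u * eta a b * d3 Phi b j n u.

(* eta, c, mu carry upper indices; (eta_{ij}) is invmx eta and (mu_{ab}) is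
   invmx mu. *)
Record potential_data U Phi eta c mu : Prop := {
  PD_eta : nondeg_sym eta;
  PD_c : nondeg_sym c;
  PD_mu : nondeg_sym mu;
  PD_block : forall (s t : 'I_k) (m n : 'I_N),
    mu (block_idx p s m) (block_idx p t n) = c s t * eta m n;
  PD_smooth : smooth_on U Phi;
  PD_WDVV : WDVV U eta Phi
}.

Definition normal_vector G r (u : pt) (v : 'rV[R]_D) : Prop :=
  forall i, bform G v (pderive i r u) = 0.

Definition normal_basis G r n (u : pt) : Prop :=
  row_free (\matrix_a n a u) /\
  forall v, normal_vector G r u v <-> (v <= \matrix_a n a u)%MS.

Definition second_form G r n (a : 'I_L) (i j : 'I_N) : pt -> R := fun u =>
  bform G (pderive i (pderive j r) u) (n a u).

Definition torsion_coef G n (i : 'I_N) (a b : 'I_L) : pt -> R := fun u =>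
  bform G (pderive i (n a) u) (n b u).

(* r : U -> (R^D, G) is a k-potential submanifold, n being a normal frame as in
   the definition. *)
Record potential_submanifold U G Phi eta c mu r n : Prop := {
  PS_ambient : nondeg_sym G;
  PS_data : potential_data U Phi eta c mu;
  PS_smooth : smooth_on U r;
  PS_immersion : forall u, U u -> row_free ('J r u);
  PS_frame_smooth : forall a, smooth_on U (n a);
  PS_frame_basis : forall u, U u -> normal_basis G r n u;
  PS_first_form : forall u, U u -> forall i j,
    bform G (pderive i r u) (pderive j r u) = invmx eta i j;
  PS_frame_gram : forall u, U u -> forall a b,
    bform G (n a u) (n b u) = invmx mu a b;
  PS_torsion : forall u, U u -> forall i a b, torsion_coef G n i a b u = 0;
  PS_second_form : forall u, U u -> forall s m i j,
    second_form G r n (block_idx p s m) i j u = d3 Phi m i j u;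
  PS_second_form0 : forall u, U u -> forall (a : 'I_L) i j, (k * N <= a)%N ->
    second_form G r n a i j u = 0
}.

(* The matrix ((A_{(s-1)N+m})^i_j). *)
Definition weingarten G eta r n (s : 'I_k) (m : 'I_N) (u : pt) : 'M[R]_N :=
  \matrix_(i, j) - \sum_l eta i l * second_form G r n (block_idx p s m) l j u.

Definition structure_fun G eta r n (s : 'I_k) (u : pt) (l m j : 'I_N) : R :=
  - weingarten G eta r n s m u l j.

End Submanifold.

(* Main.v *)
Require Import Defs.
From HB Require Import structures.
From mathcomp Require Import all_boot all_order all_algebra.
From mathcomp Require Import all_classical all_reals all_analysis.
From mathcomp Require Import ring.
Set Implicit Arguments.
Unset Strict Implicit.
Unset Printing Implicit Defensive.
Import Order.TTheory GRing.Theory Num.Theory.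
Import numFieldNormedType.Exports.
Local Open Scope classical_set_scope.
Local Open Scope ring_scope.

(* On U the structure functions are c^l_{mj} = sum_i eta^{li} d_m d_i d_j Phi,
   whatever s is; hence A(X, Y, Z) is the trilinear form of the third
   derivatives of Phi.  Its symmetry, and that of its derivative, is the
   symmetry of the iterated partial derivatives of Phi; the WDVV equations are
   the associativity of the product.  The metric is constant, so nabla is the
   componentwise derivative, and flatness is again the symmetry of second
   derivatives. *)

(** * Algebra at a point *)

Section FrobeniusForm.
Variables (R : realType) (N : nat).
Local Notation pt := 'rV[R]_N.
Implicit Types (x y z : pt) (T : 'I_N -> 'I_N -> 'I_N -> R).

(** Nested rather than a flat triple sum, so that each slot can be exchanged or differentiated
    through a statement on a single weighted sum. *)
Definition trilinear_form T x y z : R :=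
  \sum_i x 0 i * \sum_j y 0 j * \sum_k z 0 k * T i j k.

Lemma exchange_weighted_sum (a b : 'I_N -> R) (Q : 'I_N -> 'I_N -> R) :
  \sum_i a i * \sum_j b j * Q i j = \sum_j b j * \sum_i a i * Q i j.
Proof.
under eq_bigr do rewrite mulr_sumr.
rewrite exchange_big /=; apply: eq_bigr => j _.
by rewrite mulr_sumr; apply: eq_bigr => i _; rewrite mulrCA.
Qed.

Lemma trilinear_form12 T x y z : (forall i j k, T i j k = T j i k) ->
  trilinear_form T x y z = trilinear_form T y x z.
Proof.
move=> T12; rewrite /trilinear_form exchange_weighted_sum.
apply: eq_bigr => j _; congr (_ * _); apply: eq_bigr => i _; congr (_ * _).
by apply: eq_bigr => k _; rewrite T12.
Qed.

Lemma trilinear_form23 T x y z : (forall i j k, T i j k = T i k j) ->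
  trilinear_form T x y z = trilinear_form T x z y.
Proof.
move=> T23; apply: eq_bigr => i _; congr (_ * _).
rewrite exchange_weighted_sum; apply: eq_bigr => k _; congr (_ * _).
by apply: eq_bigr => j _; rewrite T23.
Qed.

(** Moves the first slot innermost, where the symmetry of a Hessian can act on it. *)
Lemma trilinear_form_rot T x y z : trilinear_form T x y z =
  \sum_j y 0 j * \sum_k z 0 k * \sum_i x 0 i * T i j k.
Proof.
rewrite /trilinear_form exchange_weighted_sum; apply: eq_bigr => j _.
by congr (_ * _); exact: exchange_weighted_sum.
Qed.

Lemma tmul_linear (c : 'I_N -> 'I_N -> 'I_N -> R) x :
  linear (tmul c x) /\ linear ((tmul c)^~ x).
Proof.
split=> a y z; apply/rowP => l; rewrite !mxE mulr_sumr -big_split;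
  apply: eq_bigr => m _; rewrite mulr_sumr -big_split;
  by apply: eq_bigr => j _; rewrite !mxE /=; ring.
Qed.

(** The hypothesis is associativity on basis vectors, [(e_i e_j) e_m = e_i (e_j e_m)], read off at
    coordinate [n]; bilinearity extends it. *)
Lemma tmulA (c : 'I_N -> 'I_N -> 'I_N -> R) :
  (forall i j m n, \sum_l c l i j * c n l m = \sum_l c l j m * c n i l) ->
  associative (tmul c).
Proof.
move=> cA x y z; apply/rowP => n; rewrite !mxE.
transitivity (\sum_i \sum_j \sum_m \sum_l
    x 0 i * y 0 j * z 0 m * (c l j m * c n i l)).
  apply: eq_bigr => i _.
  under eq_bigr do rewrite mxE mulr_sumr mulr_suml.
  rewrite exchange_big /=; apply: eq_bigr => j _.
  under eq_bigr do rewrite mulr_sumr mulr_suml.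
  rewrite exchange_big /=; apply: eq_bigr => m _; apply: eq_bigr => l _; ring.
transitivity (\sum_i \sum_j \sum_m \sum_l
    x 0 i * y 0 j * z 0 m * (c l i j * c n l m)).
  by do 3!(apply: eq_bigr => ? _); rewrite -!mulr_sumr cA.
symmetry.
under eq_bigr do under eq_bigr do rewrite mxE !mulr_suml.
under eq_bigr do rewrite exchange_big /=.
rewrite exchange_big /=; apply: eq_bigr => i _.
under eq_bigr do under eq_bigr do rewrite !mulr_suml.
under eq_bigr do rewrite exchange_big /=.
rewrite exchange_big /=; apply: eq_bigr => j _.
rewrite exchange_big /=; apply: eq_bigr => m _; apply: eq_bigr => l _; ring.
Qed.

Lemma bformC (M : 'M[R]_N) x y : M^T = M -> bform M x y = bform M y x.
Proof.
move=> MT; transitivity ((x *m M *m y^T)^T 0 0); first by rewrite mxE.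
by rewrite !trmx_mul trmxK MT mulmxA.
Qed.

Lemma bform_scalar (M : 'M[R]_N) x :
  scalar (bform M x) /\ scalar ((bform M)^~ x).
Proof.
split=> a y z; rewrite /bform.
  by rewrite linearP /= mulmxDr -scalemxAr !mxE.
by rewrite !mulmxDl -!scalemxAl !mxE.
Qed.

Lemma bform_nondeg (M : 'M[R]_N) x :
  M \in unitmx -> (forall y, bform M x y = 0) -> x = 0.
Proof.
move=> Mu x0; rewrite -[x](mulmxK Mu); suff -> : x *m M = 0 by rewrite mul0mx.
apply/rowP => j; rewrite !mxE; have := x0 (delta_mx 0 j).
by rewrite /bform trmx_delta -colE !mxE.
Qed.

(** The contracted index is the middle one of [T], as it is for the structure functions, built from
    the derivatives [d3 Phi m i j] by contraction over [i]. *)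
Definition raise_index (eta : 'M[R]_N) T (l m j : 'I_N) : R :=
  \sum_i eta l i * T m i j.

(** * The Frobenius algebra of a symmetric solution of the WDVV equations at a point *)

Section WDVVPoint.
Variables (eta : 'M[R]_N) (T : 'I_N -> 'I_N -> 'I_N -> R).
Hypothesis etaP : nondeg_sym eta.
Hypothesis T12 : forall i j k, T i j k = T j i k.
Hypothesis T23 : forall i j k, T i j k = T i k j.
Local Notation c := (raise_index eta T).

(** Separates the covector with components [T(x, e_i, y)] from its raising by [eta], so that a later
    factor [invmx eta] cancels outright. *)
Lemma tmul_raised x y :
  tmul c x y = (\row_i \sum_m \sum_j x 0 m * y 0 j * T m i j) *m eta.
Proof.
have [etaT _] := etaP; apply/rowP => l; rewrite !mxE.
under eq_bigr do under eq_bigr do rewrite mulr_sumr.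
under eq_bigr do rewrite exchange_big /=.
rewrite exchange_big /=; apply: eq_bigr => i _; rewrite mxE mulr_suml.
apply: eq_bigr => m _; rewrite mulr_suml; apply: eq_bigr => j _.
by rewrite -{1}etaT mxE; ring.
Qed.

Lemma bform_tmul x y z :
  bform (invmx eta) (tmul c x y) z = trilinear_form T x y z.
Proof.
have [_ etaU] := etaP; rewrite /bform tmul_raised mulmxK// mxE.
(* The vector [z] pairs with the middle index of [T], the one that was raised; [T23] accounts for
   its place in the last slot. *)
rewrite (trilinear_form23 _ _ _ T23) /trilinear_form.
under eq_bigr do rewrite !mxE mulr_suml.
rewrite exchange_big /=; apply: eq_bigr => m _; rewrite mulr_sumr.
apply: eq_bigr => i _; rewrite mulr_sumr mulr_suml mulr_sumr.
by apply: eq_bigr => j _; ring.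
Qed.

Lemma tmul_symC : commutative (tmul c).
Proof.
move=> x y; apply/rowP => l; rewrite !mxE exchange_big /=.
apply: eq_bigr => j _; apply: eq_bigr => m _; rewrite [x 0 m * _]mulrC.
(* Exchanging the outer indices of [T] takes three adjacent transpositions. *)
by congr (_ * _); apply: eq_bigr => i _; rewrite T12 T23 T12.
Qed.

(** Both sides are values of the symmetric trilinear form, at [(x, y, z)] and at [(y, z, x)]. *)
Lemma bform_tmul_invariant x y z :
  bform (invmx eta) (tmul c x y) z = bform (invmx eta) x (tmul c y z).
Proof.
have [etaT _] := etaP.
rewrite [RHS]bformC; last by rewrite trmx_inv etaT.
by rewrite !bform_tmul trilinear_form12// trilinear_form23.
Qed.

Hypothesis TA : forall i j m n,
  \sum_a \sum_b T i j a * eta a b * T b m n =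
  \sum_a \sum_b T i m a * eta a b * T b j n.

Lemma tmul_WDVV : associative (tmul c).
Proof.
have [etaT _] := etaP; apply: tmulA => i j m n.
have cC l k q : c l k q = c l q k.
  by apply: eq_bigr => a _; rewrite T12 T23 T12.
(* Contracting two structure functions gives one side of the WDVV equations with its last index [b]
   raised by [eta]. *)
have cE p q h : \sum_l c l p q * c n l h =
    \sum_b eta n b * \sum_a \sum_l T p q a * eta a l * T l h b.
  under eq_bigr do rewrite mulr_sumr.
  rewrite exchange_big /=; apply: eq_bigr => b _; rewrite exchange_big mulr_sumr.
  apply: eq_bigr => l _; rewrite mulrCA; congr (_ * _).
  rewrite mulr_suml; apply: eq_bigr => a _.
  by rewrite -{1}etaT mxE (T23 p a) (T23 l b); ring.
under [RHS]eq_bigr do rewrite (cC n).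
rewrite !cE; apply: eq_bigr => b _; congr (_ * _).
(* WDVV exchanges its second and third indices, so [i] and [j] are swapped first to let it exchange
   [i] with [m]. *)
by under eq_bigr do under eq_bigr do rewrite T12; rewrite TA.
Qed.

Lemma Frobenius_algebra_WDVV :
  Frobenius_algebra (tmul c) (bform (invmx eta)).
Proof.
have [etaT etaU] := etaP; split.
- exact: tmul_linear.
- exact: tmul_WDVV.
- exact: bform_scalar.
- by move=> x y; rewrite bformC// trmx_inv etaT.
- by move=> x; apply: bform_nondeg; rewrite unitmx_inv.
- exact: bform_tmul_invariant.
Qed.

End WDVVPoint.
End FrobeniusForm.

(** * Symmetry of second derivatives *)

Section SymmetryOfSecondDerivatives.
Variables (R : realType) (V : normedModType R).
Implicit Types (f : V -> R) (a b u w : V).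

(** The two difference quotients coincide as functions of [h], so derivability in the single
    direction [a] is enough. *)
Lemma is_derive_along_line f w a (s : R) : derivable f (w + s *: a) a ->
  is_derive s 1 (fun x : R => f (w + x *: a)) ('D_a f (w + s *: a)).
Proof.
have E : (fun h : R => h^-1 *: (((fun x : R => f (w + x *: a)) \o shift s)
             (h *: (1 : R)) - f (w + s *: a))) =
    (fun h : R => h^-1 *: ((f \o shift (w + s *: a)) (h *: a) - f (w + s *: a))).
  apply: funext => h /=; congr (_ *: (f _ - _)).
  by rewrite [_%:A]mulr1 scalerDl addrCA.
by move=> df; split; rewrite /derivable /derive E.
Qed.

(* MVT for s |-> f (u + s a + h b) - f (u + s a), then for
   t |-> 'D_a f (u + s a + t b). *)
Lemma second_difference f a b u (h : R) : 0 < h ->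
  (forall s t : R, 0 <= s <= h -> 0 <= t <= h ->
     differentiable f (u + s *: a + t *: b) /\
     differentiable ('D_a f) (u + s *: a + t *: b)) ->
  exists s t : R, [/\ 0 <= s <= h, 0 <= t <= h &
    f (u + h *: a + h *: b) - f (u + h *: a) - (f (u + h *: b) - f u) =
    'D_b ('D_a f) (u + s *: a + t *: b) * h ^+ 2].
Proof.
move=> h0 df; have hh : 0 <= h <= h by rewrite lexx ltW.
have zh : 0 <= (0 : R) <= h by rewrite lexx ltW.
pose phi (s : R) : R := f ((u + h *: b) + s *: a) - f (u + s *: a).
pose dphi (s : R) : R :=
  'D_a f ((u + h *: b) + s *: a) - 'D_a f (u + s *: a).
have phiP (s : R) : 0 <= s <= h -> is_derive s 1 phi (dphi s).
  move=> sh; apply: is_deriveB; apply: is_derive_along_line.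
    by apply: diff_derivable; rewrite addrAC; exact: (df _ _ sh hh).1.
  by apply: diff_derivable; rewrite -[_ + _]addr0 -(scale0r b); exact: (df _ _ sh zh).1.
have phiI (s : R) : s \in `]0, h[ -> is_derive s 1 phi (dphi s).
  by rewrite in_itv /= => /andP[s0 sh]; apply: phiP; rewrite !ltW.
have phiC : {within `[0, h], continuous phi}.
  apply: derivable_within_continuous => s.
  by rewrite in_itv /= => /phiP[].
have [s + phiE] := MVT h0 phiI phiC.
rewrite in_itv /= => /andP[s0 sh].
have sh' : 0 <= s <= h by rewrite !ltW.
have psiP (t : R) : 0 <= t <= h ->
    is_derive t 1 (fun x : R => 'D_a f (u + s *: a + x *: b))
      ('D_b ('D_a f) (u + s *: a + t *: b)).
  move=> th; apply: is_derive_along_line.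
  by apply: diff_derivable; exact: (df _ _ sh' th).2.
have psiI (t : R) : t \in `]0, h[ ->
    is_derive t 1 (fun x : R => 'D_a f (u + s *: a + x *: b))
      ('D_b ('D_a f) (u + s *: a + t *: b)).
  by rewrite in_itv /= => /andP[t0 th]; apply: psiP; rewrite !ltW.
have psiC : {within `[0, h],
    continuous (fun x : R => 'D_a f (u + s *: a + x *: b))}.
  apply: derivable_within_continuous => t.
  by rewrite in_itv /= => /psiP[].
have [t + psiE] := MVT h0 psiI psiC.
rewrite in_itv /= => /andP[t0 th].
exists s, t; split; [by []|by rewrite !ltW|].
move: phiE; rewrite /phi !scale0r !addr0 subr0 /dphi (addrAC u) => ->.
move: psiE; rewrite scale0r addr0 subr0 (addrAC u) => ->.
by rewrite expr2 mulrA.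
Qed.

(** Schwarz's theorem. The second difference of [f] over a small parallelogram is symmetric in [a]
    and [b]; by [second_difference] it equals [h ^+ 2] times either mixed derivative at some point
    of the parallelogram, and continuity compares these values with those at [u]. *)
Lemma derive_comm f a b u :
  (\forall v \near u, differentiable f v) ->
  (\forall v \near u, differentiable ('D_a f) v) ->
  (\forall v \near u, differentiable ('D_b f) v) ->
  {for u, continuous ('D_a ('D_b f))} -> {for u, continuous ('D_b ('D_a f))} ->
  'D_a ('D_b f) u = 'D_b ('D_a f) u.
Proof.
move=> df dfa dfb /cvgrPdist_lt cab /cvgrPdist_lt cba.
apply/eqP; rewrite -subr_eq0 -normr_le0; apply/ler_addgt0Pr => e e0.
rewrite add0r; have e2 : 0 < e / 2 by rewrite divr_gt0.
have : \forall v \near u, [/\ differentiable f v, differentiable ('D_a f) v,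
     differentiable ('D_b f) v, `|'D_a ('D_b f) u - 'D_a ('D_b f) v| < e / 2 &
     `|'D_b ('D_a f) u - 'D_b ('D_a f) v| < e / 2].
  have /= cab' := cab _ e2; have /= cba' := cba _ e2.
  have FI (P Q : set V) : nbhs u P -> nbhs u Q -> nbhs u (P `&` Q).
    exact: filterI.
  apply: filterS (FI _ _ df (FI _ _ dfa (FI _ _ dfb (FI _ _ cab' cba')))).
  move=> v [h1 [h2 [h3 [h4 h5]]]]; exact (And5 h1 h2 h3 h4 h5).
move=> /nbhs_ballP[d /= d0 dP].
(* This size keeps [u + s *: a + t *: b] in the ball of radius [d] for all [s], [t] in [[0, h]]; the
   [+ 1] keeps the denominator positive even if [a] and [b] vanish. *)
pose h := d / (`|a| + `|b| + 1).
have n0 : 0 < `|a| + `|b| + 1 by rewrite ltr_wpDl// addr_ge0.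
have h0 : 0 < h by rewrite divr_gt0.
have inball (s t : R) : 0 <= s <= h -> 0 <= t <= h ->
    ball u d (u + s *: a + t *: b).
  move=> /andP[s0 sh] /andP[t0 th].
  rewrite -ball_normE /= -addrA opprD addNKr normrN.
  rewrite (le_lt_trans (ler_normD _ _))// !normrZ !ger0_norm//.
  apply: (@le_lt_trans _ _ (h * (`|a| + `|b|))).
    by rewrite mulrDr lerD// ler_wpM2r.
  by rewrite /h mulrAC ltr_pdivrMr// ltr_pM2l// ltrDl.
have [s t sh th|s [t [sh th E1]]] := @second_difference f a b u h h0.
  by have [? ? _ _ _] := dP _ (inball _ _ sh th); split.
have [t1 s1 th1 sh1|t' [s' [th' sh' E2]]] := @second_difference f b a u h h0.
  by have [? _ ? _ _] := dP _ (inball _ _ sh1 th1); rewrite addrAC; split.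
have [_ _ _ _ B1] := dP _ (inball _ _ sh th).
have [_ _ _ B2 _] := dP _ (inball _ _ sh' th').
rewrite addrAC in B2.
(* The two second differences differ only in the order of their terms, so dividing by [h ^+ 2]
   equates the mixed derivatives, each at its own point. *)
have E : 'D_a ('D_b f) (u + t' *: b + s' *: a) =
         'D_b ('D_a f) (u + s *: a + t *: b).
  have h2 : h ^+ 2 != 0 by rewrite expf_eq0 /= gt_eqF.
  apply: (mulIf h2); apply: etrans (esym E2) _; apply: etrans _ E1.
  rewrite (addrAC u (h *: b)).
  move: (f _) (f _) (f _) (f _) => w x y z; ring.
rewrite E in B2; rewrite (splitr e).
apply: le_trans (ler_distD _ _ _) (lerD (ltW B2) _).
rewrite distrC; exact: (ltW B1).
Qed.

End SymmetryOfSecondDerivatives.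

(** * Smooth fields on an open set *)

(** The first-order expansion of [f] at [u] is also one of [g], since the two agree near [u] and at
    [u]; [diff_unique] identifies its linear part with the differential of [g]. *)
Lemma near_eq_differentiable (K : numFieldType) (V W : normedModType K)
    (f g : V -> W) u :
  (\forall v \near u, f v = g v) -> differentiable f u -> differentiable g u.
Proof.
move=> fg /diff_locallyP [dfc fE].
have fgu : f u = g u := nbhs_singleton fg.
have gE : g \o shift u = cst (g u) + 'd f u +o_ 0 id.
  apply/eqaddoP => e e0; move/eqaddoP : fE => /(_ e e0).
  have : \forall h \near (0 : V), f (h + u) = g (h + u).
    by move: fg; rewrite (near_shift 0 u) subr0.
  by apply: filterS2 => h fgh; rewrite !fctE /= fgh fgu.
have dgE := diff_unique dfc gE.
by apply/diff_locallyP; rewrite dgE.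
Qed.

Section SmoothOn.
Variables (R : realType) (N : nat) (U : set 'rV[R]_N).
Hypothesis Uopen : open U.
Local Notation pt := 'rV[R]_N.

Lemma near_eq_on (T : Type) (f g : pt -> T) u :
  (forall v, U v -> f v = g v) -> U u -> \forall v \near u, f v = g v.
Proof.
move=> fg Uu; apply: (@filterS _ _ _ U) => [v /fg //|].
exact: open_nbhs_nbhs.
Qed.

Lemma derive_eq_on (V : normedModType R) (f g : pt -> V) w u :
  (forall v, U v -> f v = g v) -> U u -> 'D_w f u = 'D_w g u.
Proof. by move=> fg Uu; apply/near_eq_derive/near_eq_on. Qed.

Lemma foldr_pderive_eq_on (V : normedModType R) (f g : pt -> V) s u :
  (forall v, U v -> f v = g v) -> U u ->
  foldr (@pderive R N V) f s u = foldr (@pderive R N V) g s u.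
Proof.
move=> fg; elim: s u => [u /fg //|i s IHs u Uu] /=.
exact: derive_eq_on.
Qed.

Lemma smooth_on_differentiable (V : normedModType R) (f : pt -> V) u :
  smooth_on U f -> U u -> differentiable f u.
Proof. by move=> /(_ [::]); apply. Qed.

Lemma smooth_on_pderive (V : normedModType R) (f : pt -> V) i :
  smooth_on U f -> smooth_on U (pderive i f).
Proof. by move=> sf s u Uu; rewrite -foldr_rcons; apply: sf. Qed.

Lemma smooth_on_cst (V : normedModType R) (x : V) : smooth_on U (fun=> x).
Proof.
(* Every iterated derivative is constant, so the induction on [s] only has to carry some constant
   [y]. *)
move=> s u _; suff [y ->] : exists y : V,
    foldr (@pderive R N V) (fun=> x) s = cst y by exact: differentiable_cst.
elim: s => [|i s [y IHs]]; first by exists x.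
by exists 0; rewrite /= IHs; apply: funext => v; apply: derive_cst.
Qed.

Lemma pderiveC (f : pt -> R) i j u : smooth_on U f -> U u ->
  pderive i (pderive j f) u = pderive j (pderive i f) u.
Proof.
move=> sf Uu.
have near_diff (g : pt -> R) :
    smooth_on U g -> \forall v \near u, differentiable g v.
  move=> sg; apply: (@filterS _ _ _ U) => [v Uv|]; last exact: open_nbhs_nbhs.
  exact: smooth_on_differentiable.
apply: derive_comm.
- exact: near_diff.
- by apply: near_diff; apply: smooth_on_pderive.
- by apply: near_diff; apply: smooth_on_pderive.
- apply: differentiable_continuous; apply: smooth_on_differentiable Uu.
  by do 2!apply: smooth_on_pderive.
- apply: differentiable_continuous; apply: smooth_on_differentiable Uu.
  by do 2!apply: smooth_on_pderive.
Qed.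

(** Lets a function be replaced by a formula known only on [U], as is the case for the structure
    functions. *)
Lemma smooth_on_ext (V : normedModType R) (f g : pt -> V) :
  (forall v, U v -> f v = g v) -> smooth_on U f -> smooth_on U g.
Proof.
move=> fg sf s u Uu; apply: near_eq_differentiable (sf s u Uu).
by apply: near_eq_on => // v Uv; apply: foldr_pderive_eq_on.
Qed.

Lemma differentiable_sumM n (f g : 'I_n -> pt -> R) u :
  (forall l, differentiable (f l) u) -> (forall l, differentiable (g l) u) ->
  differentiable (fun v => \sum_l f l v * g l v) u.
Proof.
move=> df dg.
have -> : (fun v => \sum_l f l v * g l v) = \sum_l (f l * g l).
  by rewrite fct_sumE.
by apply: differentiable_sum => l; apply: differentiableM; [exact: df|exact: dg].
Qed.

Lemma derive_sumM n (f g : 'I_n -> pt -> R) w u :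
  (forall l, differentiable (f l) u) -> (forall l, differentiable (g l) u) ->
  'D_w (fun v => \sum_l f l v * g l v) u =
  \sum_l ('D_w (f l) u * g l u + f l u * 'D_w (g l) u).
Proof.
move=> df dg.
have -> : (fun v => \sum_l f l v * g l v) = \sum_l (f l * g l).
  by rewrite fct_sumE.
rewrite derive_sum => [|l]; last first.
  by apply: derivableM; apply: diff_derivable; [exact: df|exact: dg].
apply: eq_bigr => l _; rewrite deriveM.
- by rewrite addrC mulrC.
- by apply: diff_derivable; exact: df.
- by apply: diff_derivable; exact: dg.
Qed.

Lemma derive_sumZ n (a : 'I_n -> R) (f : 'I_n -> pt -> R) w u :
  (forall l, differentiable (f l) u) ->
  'D_w (fun v => \sum_l a l * f l v) u = \sum_l a l * 'D_w (f l) u.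
Proof.
move=> df; rewrite (@derive_sumM _ (fun l => cst (a l))).
- by apply: eq_bigr => l _; rewrite derive_cst mul0r add0r.
- by move=> l; exact: differentiable_cst.
- exact: df.
Qed.

Lemma smooth_on_sumZ n (a : 'I_n -> R) (f : 'I_n -> pt -> R) :
  (forall l, smooth_on U (f l)) -> smooth_on U (fun u => \sum_l a l * f l u).
Proof.
move=> sf.
(* Linearity of the iterated derivatives is established only at points of [U], where
   differentiability is given; as [U] is open, this suffices to differentiate once more. *)
have E s v : U v -> \sum_l a l * foldr (@pderive R N R) (f l) s v =
    foldr (@pderive R N R) (fun u => \sum_l a l * f l u) s v.
  elim: s v => [//|i s IHs] v Uv /=.
  rewrite /pderive -(derive_eq_on _ IHs)// derive_sumZ// => l.
  exact: sf.
move=> s u Uu; apply: near_eq_differentiable (near_eq_on (E s) Uu) _.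
apply: (@differentiable_sumM _ (fun l => cst (a l))) => l.
  exact: differentiable_cst.
exact: sf.
Qed.

Lemma derive_coord (Z : pt -> pt) k w u : differentiable Z u ->
  'D_w (fun v => Z v 0 k) u = ('D_w Z u) 0 k.
Proof. by move=> dZ; rewrite derive_mx ?mxE//; exact: diff_derivable. Qed.

Lemma smooth_on_coord (Z : pt -> pt) k :
  smooth_on U Z -> smooth_on U (fun u => Z u 0 k).
Proof.
move=> sZ.
have E s v : U v -> (foldr (@pderive R N _) Z s v) 0 k =
    foldr (@pderive R N R) (fun u => Z u 0 k) s v.
  elim: s v => [//|i s IHs] v Uv /=.
  by rewrite /pderive -(derive_eq_on _ IHs)// derive_coord//; exact: sZ.
move=> s u Uu; apply: near_eq_differentiable (near_eq_on (E s) Uu) _.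
apply: (@differentiable_comp _ _ _ _ _ (fun x : pt => x 0 k)).
  exact: sZ.
exact: differentiable_coord.
Qed.

Lemma derive_pderive (f : pt -> R) w u : differentiable f u ->
  'D_w f u = \sum_i w 0 i * pderive i f u.
Proof.
move=> df; rewrite deriveE// {1}(row_sum_delta w) linear_sum.
by apply: eq_bigr => i _; rewrite linearZ /= /pderive deriveE.
Qed.

Lemma derive_coord_pderive (Z : pt -> pt) k w u : differentiable Z u ->
  ('D_w Z u) 0 k = \sum_i w 0 i * pderive i (fun v => Z v 0 k) u.
Proof.
move=> dZ; rewrite -derive_coord// derive_pderive//.
apply: (@differentiable_comp _ _ _ _ _ (fun x : pt => x 0 k)) => //.
exact: differentiable_coord.
Qed.

(** For a constant metric this is a coordinate of the iterated covariant derivative; the Leibniz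
    rule isolates the second-order part, which is to cancel in the curvature. *)
Lemma derive_derive_coord (Y Z : pt -> pt) k w u :
  smooth_on U Y -> smooth_on U Z -> U u ->
  ('D_w (fun v => 'D_(Y v) Z v) u) 0 k =
  \sum_j ('D_w (fun v => Y v 0 j) u * pderive j (fun v => Z v 0 k) u +
          Y u 0 j * 'D_w (pderive j (fun v => Z v 0 k)) u).
Proof.
move=> sY sZ Uu.
have E l v : U v -> \sum_j Y v 0 j * pderive j (fun v => Z v 0 l) v =
    ('D_(Y v) Z v) 0 l.
  by move=> Uv; rewrite derive_coord_pderive//; exact: smooth_on_differentiable sZ Uv.
have dY j : differentiable (fun v => Y v 0 j) u.
  by apply: smooth_on_differentiable Uu; exact: smooth_on_coord.
have dZ l j : differentiable (pderive j (fun v => Z v 0 l)) u.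
  apply: smooth_on_differentiable Uu.
  by apply: smooth_on_pderive; exact: smooth_on_coord.
(* Derivability of [v |-> 'D_(Y v) Z v] comes from the coordinate expansion [E], by agreement near
   [u]. *)
rewrite derive_mx; last first.
  apply/derivable_mxP => i l; rewrite ord1.
  apply: near_eq_derivable (near_eq_on (E l) Uu) _.
  by apply: diff_derivable; apply: differentiable_sumM.
by rewrite mxE -(derive_eq_on _ (E k))// derive_sumM.
Qed.

(** * Constant metrics: the Levi-Civita connection and flatness *)

Lemma tmul0 (x y : pt) : tmul (fun _ _ _ => 0) x y = 0.
Proof.
apply/rowP => l; rewrite !mxE big1// => m _; rewrite big1// => j _.
by rewrite mulr0.
Qed.

Lemma nabla_cst (M : 'M[R]_N) (X Y : pt -> pt) :
  nabla (fun=> M) X Y = fun u => 'D_(X u) Y u.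
Proof.
apply: funext => u; rewrite /nabla.
have -> : christoffel (fun=> M) u = fun _ _ _ => 0.
  apply: funext => k; apply: funext => i; apply: funext => j.
  rewrite /christoffel big1 ?mulr0// => l _.
  by rewrite /pderive !derive_cst addr0 subr0 mulr0.
by rewrite tmul0 addr0.
Qed.

(** Both sides are the Hessian of [f] at [u] on [x] and [y]. This serves the curvature and, with
    second derivatives of [Phi] as [f], the symmetry of [nablaA]. *)
Lemma derive_pderive_sym (f : pt -> R) (x y : pt) u : smooth_on U f -> U u ->
  \sum_j x 0 j * 'D_y (pderive j f) u = \sum_j y 0 j * 'D_x (pderive j f) u.
Proof.
move=> sf Uu.
have D (w : pt) j : 'D_w (pderive j f) u =
    \sum_i w 0 i * pderive i (pderive j f) u.
  apply: derive_pderive; apply: smooth_on_differentiable Uu.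
  exact: smooth_on_pderive.
transitivity (\sum_j \sum_i x 0 j * (y 0 i * pderive i (pderive j f) u)).
  by apply: eq_bigr => j _; rewrite D mulr_sumr.
rewrite exchange_big /=; apply: eq_bigr => i _.
rewrite [in RHS]D mulr_sumr; apply: eq_bigr => j _.
by rewrite mulrCA (pderiveC _ _ sf Uu).
Qed.

(** The algebra behind [[D_X, D_Y] Z = D_[X, Y] Z]: [x], [y], [xy], [yx] are the components of [X],
    [Y], [D_X Y], [D_Y X], while [d] is the gradient of a component of [Z] and [a], [b] are its
    derivatives along [X] and [Y]. The hypothesis is the symmetry of a Hessian. *)
Lemma commutator_cancel n (x y xy yx d a b : 'I_n -> R) :
  \sum_j x j * b j = \sum_j y j * a j ->
  \sum_j (xy j * d j + y j * a j) - \sum_j (yx j * d j + x j * b j) =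
  \sum_j (xy j - yx j) * d j.
Proof.
move=> E; rewrite !big_split /= E opprD addrACA subrr addr0 -sumrB.
by apply: eq_bigr => j _; rewrite mulrBl.
Qed.

Lemma flat_metric_cst (M : 'M[R]_N) : flat_metric U (fun=> M).
Proof.
move=> X Y Z sX sY sZ u Uu; rewrite /curvature !nabla_cst /bracket.
apply/eqP; rewrite subr_eq0; apply/eqP/rowP => k.
have sZk : smooth_on U (fun v => Z v 0 k) by exact: smooth_on_coord.
have subE (x y : pt) i : (x - y) 0 i = x 0 i - y 0 i by rewrite !mxE.
have sub_eq (a a' b b' : R) : a = a' -> b = b' -> a - b = a' - b'.
  by move=> -> ->.
apply: etrans (subE _ _ _) _.
apply: etrans (sub_eq _ _ _ _ (derive_derive_coord k (X u) sY sZ Uu)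
  (derive_derive_coord k (Y u) sX sZ Uu)) _.
apply: etrans (esym (derive_coord_pderive k _ (smooth_on_differentiable sZ Uu))).
apply: etrans (commutator_cancel _ _ _ _) _.
  exact: derive_pderive_sym sZk Uu.
apply: eq_bigr => j _; congr (_ * _); apply: etrans (esym (subE _ _ _)).
exact: sub_eq (derive_coord _ _ (smooth_on_differentiable sY Uu))
  (derive_coord _ _ (smooth_on_differentiable sX Uu)).
Qed.

(** The product rule, one slot at a time. The first three terms are those that [nablaA] subtracts
    for a constant metric, so that only the derivative of [T] survives there. *)
Lemma derive_trilinear_form (T : pt -> 'I_N -> 'I_N -> 'I_N -> R)
    (X Y Z : pt -> pt) w u :
  smooth_on U X -> smooth_on U Y -> smooth_on U Z ->
  (forall i j k, smooth_on U (fun v => T v i j k)) -> U u ->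
  'D_w (fun v => trilinear_form (T v) (X v) (Y v) (Z v)) u =
  trilinear_form (T u) ('D_w X u) (Y u) (Z u) +
  trilinear_form (T u) (X u) ('D_w Y u) (Z u) +
  trilinear_form (T u) (X u) (Y u) ('D_w Z u) +
  trilinear_form (fun i j k => 'D_w (fun v => T v i j k) u) (X u) (Y u) (Z u).
Proof.
move=> sX sY sZ sT Uu.
have dc (F : pt -> pt) i : smooth_on U F -> differentiable (fun v => F v 0 i) u.
  by move=> sF; apply: smooth_on_differentiable Uu; exact: smooth_on_coord.
have cE (F : pt -> pt) i : smooth_on U F ->
    'D_w (fun v => F v 0 i) u = ('D_w F u) 0 i.
  by move=> sF; apply: derive_coord; exact: smooth_on_differentiable sF Uu.
have dT i j k : differentiable (fun v => T v i j k) u.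
  exact: smooth_on_differentiable (sT i j k) Uu.
have dZT i j : differentiable (fun v => \sum_k Z v 0 k * T v i j k) u.
  by apply: differentiable_sumM => k; [exact: dc|exact: dT].
have dYZT i : differentiable
    (fun v => \sum_j Y v 0 j * \sum_k Z v 0 k * T v i j k) u.
  by apply: differentiable_sumM => j; [exact: dc|exact: dZT].
rewrite /trilinear_form derive_sumM; [|by move=> i; exact: dc|exact: dYZT].
rewrite -!big_split /=; apply: eq_bigr => i _; rewrite (cE X i sX).
rewrite -!addrA; congr (_ + _); rewrite -!mulrDr; congr (_ * _).
rewrite derive_sumM; [|by move=> j; exact: dc|exact: dZT].
rewrite -!big_split /=; apply: eq_bigr => j _; rewrite (cE Y j sY).
congr (_ + _); rewrite -!mulrDr; congr (_ * _).
rewrite derive_sumM; [|by move=> k; exact: dc|exact: dT].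
by rewrite -!big_split /=; apply: eq_bigr => k _; rewrite (cE Z k sZ).
Qed.

(** * The Dubrovin-Frobenius structure of a potential *)

Section PotentialStructure.
Variables (eta : 'M[R]_N) (Phi : pt -> R) (c : pt -> 'I_N -> 'I_N -> 'I_N -> R).
Hypothesis etaP : nondeg_sym eta.
Hypothesis sPhi : smooth_on U Phi.
Hypothesis PhiA : WDVV U eta Phi.
Hypothesis cE : forall u, U u ->
  c u = raise_index eta (fun i j k => d3 Phi i j k u).

Lemma smooth_on_d3 i j k : smooth_on U (d3 Phi i j k).
Proof. by do 3!apply: smooth_on_pderive. Qed.

Lemma d3_sym12 u i j k : U u -> d3 Phi i j k u = d3 Phi j i k u.
Proof. by move=> Uu; apply: pderiveC Uu; exact: smooth_on_pderive. Qed.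

Lemma d3_sym23 u i j k : U u -> d3 Phi i j k u = d3 Phi i k j u.
Proof.
by move=> Uu; apply: derive_eq_on Uu => v Uv; exact: pderiveC sPhi Uv.
Qed.

Lemma tensorAE u X Y Z : U u -> tensorA (fun=> invmx eta) c X Y Z u =
  trilinear_form (fun i j k => d3 Phi i j k u) (X u) (Y u) (Z u).
Proof.
move=> Uu.
change (bform (invmx eta) (tmul (c u) (X u) (Y u)) (Z u) =
  trilinear_form (fun i j k => d3 Phi i j k u) (X u) (Y u) (Z u)).
rewrite (cE Uu); apply: (bform_tmul etaP).
by move=> i j k; exact: d3_sym23.
Qed.

Lemma nablaA_E W X Y Z u :
  smooth_on U X -> smooth_on U Y -> smooth_on U Z -> U u ->
  nablaA (fun=> invmx eta) c W X Y Z u =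
  trilinear_form (fun i j k => 'D_(W u) (d3 Phi i j k) u) (X u) (Y u) (Z u).
Proof.
move=> sX sY sZ Uu; rewrite /nablaA !nabla_cst !tensorAE//.
rewrite (derive_eq_on _ (fun v => @tensorAE v X Y Z) Uu).
rewrite derive_trilinear_form//; last exact: smooth_on_d3.
have cancel3 (a b d e : R) : a + b + d + e - a - b - d = e by ring.
exact: cancel3.
Qed.

(** Once the first slot is innermost, each inner sum is the Hessian of [pderive j (pderive k Phi)]
    on [w] and [x]. *)
Lemma derive_d3_exchange (w x y z : pt) u : U u ->
  trilinear_form (fun i j k => 'D_w (d3 Phi i j k) u) x y z =
  trilinear_form (fun i j k => 'D_x (d3 Phi i j k) u) w y z.
Proof.
move=> Uu.
apply: etrans (trilinear_form_rot _ _ _ _) _.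
apply: etrans (esym (trilinear_form_rot _ _ _ _)).
apply: eq_bigr => j _; apply: congr1.
apply: eq_bigr => k _; apply: congr1; apply: derive_pderive_sym Uu.
by do 2!apply: smooth_on_pderive.
Qed.

Lemma Dubrovin_Frobenius_potential : Dubrovin_Frobenius U (fun=> invmx eta) c.
Proof.
have [etaT etaU] := etaP.
have t12 u (Uu : U u) i j k := @d3_sym12 u i j k Uu.
have t23 u (Uu : U u) i j k := @d3_sym23 u i j k Uu.
(* The symmetries of the third derivatives hold on all of the open set [U], hence pass to
   directional derivatives. *)
have D12 u w (Uu : U u) i j k :
    'D_w (d3 Phi i j k) u = 'D_w (d3 Phi j i k) u.
  by apply: derive_eq_on Uu => v Uv; exact: d3_sym12.
have D23 u w (Uu : U u) i j k :
    'D_w (d3 Phi i j k) u = 'D_w (d3 Phi i k j) u.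
  by apply: derive_eq_on Uu => v Uv; exact: d3_sym23.
split.
- split=> [i j|u _]; first exact: smooth_on_cst.
  by split; [rewrite trmx_inv etaT|rewrite unitmx_inv].
- move=> l m j.
  apply: (@smooth_on_ext _ (fun u => \sum_i eta l i * d3 Phi m i j u)).
    by move=> v Uv; rewrite (cE Uv).
  by apply: smooth_on_sumZ => i; exact: smooth_on_d3.
- move=> X Y Z _ _ _ u Uu.
  change (bform (invmx eta) (tmul (c u) (X u) (Y u)) (Z u) =
          bform (invmx eta) (X u) (tmul (c u) (Y u) (Z u))).
  rewrite (cE Uu).
  by apply: bform_tmul_invariant etaP _ _ _ _ _; [exact: t12|exact: t23].
- move=> X Y _ _ u Uu.
  change (tmul (c u) (X u) (Y u) = tmul (c u) (Y u) (X u)); rewrite (cE Uu).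
  by apply: tmul_symC; [exact: t12|exact: t23].
- move=> X Y Z _ _ _ u Uu; symmetry.
  change (tmul (c u) (X u) (tmul (c u) (Y u) (Z u)) =
          tmul (c u) (tmul (c u) (X u) (Y u)) (Z u)); rewrite (cE Uu).
  by apply: tmul_WDVV etaP _ _ _ _ _ _; [exact: t12|exact: t23|exact: PhiA].
- exact: flat_metric_cst.
- move=> X Y Z _ _ _ u Uu; rewrite !tensorAE//.
  by split; [apply: trilinear_form12; exact: t12|
    apply: trilinear_form23; exact: t23].
- move=> W X Y Z sW sX sY sZ u Uu.
  split; apply: etrans (nablaA_E W sX sY sZ Uu) _.
  + apply: etrans (esym (nablaA_E X sW sY sZ Uu)).
    exact: derive_d3_exchange.
  + apply: etrans (esym (nablaA_E W sY sX sZ Uu)).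
    by apply: trilinear_form12; exact: D12.
  + apply: etrans (esym (nablaA_E W sX sZ sY Uu)).
    by apply: trilinear_form23; exact: D23.
Qed.

End PotentialStructure.
End SmoothOn.

(** * The structures carried by a potential submanifold *)

Theorem theorem5p3 (R : realType) (N k p : nat) (hN : (1 <= N)%N)
    (hk : (1 <= k)%N) (U : set 'rV[R]_N) (hU : open U)
    (Phi : 'rV[R]_N -> R) (eta : 'M[R]_N) (c : 'M[R]_k)
    (mu : 'M[R]_(k * N + p)) (G : 'M[R]_(k.+1 * N + p))
    (r : 'rV[R]_N -> 'rV[R]_(k.+1 * N + p))
    (n : 'I_(k * N + p) -> 'rV[R]_N -> 'rV[R]_(k.+1 * N + p))
    (hr : potential_submanifold U G Phi eta c mu r n) :
  [/\ forall (s : 'I_k) (u : 'rV[R]_N) (l m j : 'I_N), U u ->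
        structure_fun G eta r n s u l m j =
        \sum_i eta l i * second_form G r n (block_idx p s m) i j u,
      forall s : 'I_k,
        Dubrovin_Frobenius U (fun=> invmx eta) (structure_fun G eta r n s),
      forall (s : 'I_k) (u : 'rV[R]_N), U u ->
        Frobenius_algebra (tmul (structure_fun G eta r n s u))
          (bform (invmx eta)) /\
        commutative (tmul (structure_fun G eta r n s u)) &
      forall (s t : 'I_k) (u : 'rV[R]_N), U u ->
        tmul (structure_fun G eta r n s u) =
        tmul (structure_fun G eta r n t u)].
Proof.
have [[etaP _ _ _ sPhi PhiA] second_formE] := (PS_data hr, PS_second_form hr).
have structureE s u l m j : structure_fun G eta r n s u l m j =
    \sum_i eta l i * second_form G r n (block_idx p s m) i j u.
  by rewrite /structure_fun mxE opprK.
(* The index [s] disappears here: in every block the second fundamental forms are the same third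
   derivatives of [Phi]. *)
have cE s u : U u -> structure_fun G eta r n s u =
    raise_index eta (fun i j k => d3 Phi i j k u).
  move=> Uu; apply: funext => l; apply: funext => m; apply: funext => j.
  by rewrite structureE; apply: eq_bigr => i _; rewrite second_formE.
split=> [s u l m j _|s|s u Uu|s t u Uu].
- exact: structureE.
- exact: (Dubrovin_Frobenius_potential hU etaP sPhi PhiA (cE s)).
- rewrite (cE s u Uu); split.
    apply: Frobenius_algebra_WDVV etaP _ _ _.
    + by move=> i j l; exact: (d3_sym12 hU sPhi).
    + by move=> i j l; exact: (d3_sym23 hU sPhi).
    + exact: PhiA.
  apply: tmul_symC.
  + by move=> i j l; exact: (d3_sym12 hU sPhi).
  + by move=> i j l; exact: (d3_sym23 hU sPhi).
- by rewrite (cE s u Uu) (cE t u Uu).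
Qed.
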